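(* Let $k\ge 1$ be an integer and let $X$ be a random variable with values in $[-1,1]$ that has the $\operatorname{Beta}(1/2,1/2)$ distribution scaled and shifted to $[-1,1]$, that is, with probability density function $$f_X(x)=\frac{1}{\pi\sqrt{1-x^2}},\qquad x\in(-1,1).$$ Then $T_k(X)$ has the same distribution as $X$. In other words, this distribution is invariant under the transformation $T_k:[-1,1]\to[-1,1]$.
   Context: For an integer $k\ge 1$, $T_k$ denotes the $k$-th Chebyshev polynomial of the first kind, given on $[-1,1]$ by $T_k(x)=\cos(k\cos^{-1}(x))$, where $\cos^{-1}=\arccos:[-1,1]\to[0,\pi]$. The scaled and shifted $\operatorname{Beta}(1/2,1/2)$ distribution on $[-1,1]$ is the law of $2Y-1$ where $Y\sim\operatorname{Beta}(1/2,1/2)$ on $[0,1]$. *)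

(* Defs.v *)
From HB Require Import structures.
From mathcomp Require Import all_boot all_order all_algebra.
From mathcomp Require Import all_classical all_reals all_analysis.
From mathcomp Require Import ring.

Set Implicit Arguments.
Unset Strict Implicit.
Unset Printing Implicit Defensive.

Import Order.TTheory GRing.Theory Num.Theory.
Import numFieldNormedType.Exports.

Local Open Scope classical_set_scope.
Local Open Scope ring_scope.

(* Only the values of a polynomial on [-1, 1] are prescribed here; this
   determines the polynomial (is_chebyshevT_inj). *)
Definition is_chebyshevT (R : realType) (k : nat) (p : {poly R}) : Prop :=
  forall x : R, x \in `[-1, 1] -> p.[x] = cos (k%:R * acos x).

Definition chebyshevT (R : realType) (k : nat) : {poly R} :=
  xget 0 [set p : {poly R} | is_chebyshevT k p].

Lemma is_chebyshevT_inj (R : realType) (k : nat) (p q : {poly R}) :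
  is_chebyshevT k p -> is_chebyshevT k q -> p = q.
Proof.
move=> hp hq; apply/eqP; rewrite -subr_eq0; apply/eqP.
pose rs : seq R := [seq (i.+1%:R)^-1 | i <- iota 0 (size (p - q))].
apply: (@roots_geq_poly_eq0 _ (p - q) rs); last by rewrite size_map size_iota.
- apply/allP => _ /mapP[i _ ->].
  have i01 : (i.+1%:R)^-1 \in `[-1, 1 : R].
    rewrite in_itv/= invf_le1 ?ltr0n// ler1n andbT.
    by rewrite (@le_trans _ _ 0)// ?invr_ge0 ?ler0n// oppr_le0 ler01.
  by rewrite /root hornerD hornerN hp// hq// subrr.
- rewrite map_inj_uniq ?iota_uniq// => i j /invr_inj /eqP.
  by rewrite eqr_nat eqSS => /eqP.
Qed.

Lemma is_chebyshevT_ex (R : realType) (k : nat) :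
  exists p : {poly R}, is_chebyshevT k p.
Proof.
suff [p [q [hp _]]] : exists p q : {poly R},
  is_chebyshevT k p /\ is_chebyshevT k.+1 q by exists p.
elim: k => [|k [p [q [hp hq]]]].
- exists 1, 'X; split=> x x11; first by rewrite hornerC mul0r cos0.
  by rewrite hornerX mul1r acosK.
- exists q, ('X * q *+ 2 - p); split=> // x x11.
  rewrite hornerD hornerN hornerMn hornerM hornerX hp// hq//.
  set t := acos x; rewrite -[in x * _](acosK x11) -/t.
  have -> : k.+2%:R * t = k.+1%:R * t + t.
    by rewrite -(addn1 k.+1) natrD mulrDl mul1r.
  have -> : k%:R * t = k.+1%:R * t - t.
    by rewrite -(addn1 k) natrD mulrDl mul1r addrK.
  by rewrite cosB cosD; ring.
Qed.

Lemma chebyshevTP (R : realType) (k : nat) : is_chebyshevT k (chebyshevT R k).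
Proof.
have [p hp] := is_chebyshevT_ex R k.
by rewrite /chebyshevT; case: xgetP => [q _ //|/(_ p)].
Qed.

Lemma chebyshevT_itv (R : realType) (k : nat) (x : R) :
  x \in `[-1, 1] -> (chebyshevT R k).[x] \in `[-1, 1].
Proof. by move=> x11; rewrite chebyshevTP// in_itv/= cos_geN1 cos_le1. Qed.

HB.instance Definition _ (R : realType) (p : {poly R}) :=
  isMeasurableFun.Build _ _ _ _ (horner p) (@measurable_poly R p setT).

(* Density of 2 Y - 1 for Y of law Beta(1/2, 1/2) on [0, 1]; the library's
   beta_prob only takes parameters in nat. *)
Definition beta_half_pdf (R : realType) (x : R) : R :=
  if -1 < x < 1 then 1 / (pi * Num.sqrt (1 - x ^+ 2)) else 0.

Definition beta_half_law (R : realType) (A : set R) : \bar R :=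
  (\int[lebesgue_measure]_(x in A) (beta_half_pdf x)%:E)%E.

(* Main.v *)
Require Import Defs.
From mathcomp Require Import all_boot all_order all_algebra.
From mathcomp Require Import all_classical all_reals all_analysis.
From mathcomp Require Import measurable_realfun ring lra.

Set Implicit Arguments.
Unset Strict Implicit.
Unset Printing Implicit Defensive.

Import Order.TTheory GRing.Theory Num.Theory.
Import numFieldNormedType.Exports.

Local Open Scope classical_set_scope.
Local Open Scope ring_scope.

(* Under the arcsine law the angle acos X is uniform on [0, pi], and in terms
   of the angle t the map T_k is t |-> k t followed by folding onto [0, pi].
   On each of the k arcs of length pi/k the preimage of {x >= cos a} is
   an arc of length a/k, so T_k^-1 {x >= cos a} has law k (a/k)/pi = a/pi, the
   law of {x >= cos a} itself.  Half-lines form a pi-system generating the Borel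
   sets, which concludes. *)

(** * Angles in [0, pi] as coordinates on [-1, 1] *)

Lemma ltr_cos_pi (R : realType) (a b : R) :
  0 <= a <= pi -> 0 <= b <= pi -> (cos a < cos b) = (b < a).
Proof. by move=> a0pi b0pi; rewrite ltr_cos// in_itv. Qed.

Lemma ler_cos_pi (R : realType) (a b : R) :
  0 <= a <= pi -> 0 <= b <= pi -> (cos a <= cos b) = (b <= a).
Proof. by move=> a0pi b0pi; rewrite !leNgt ltr_cos_pi. Qed.

Lemma cos_acos_ex (R : realType) (x : R) :
  -1 <= x <= 1 -> exists2 t : R, 0 <= t <= pi & x = cos t.
Proof.
move=> x11; exists (acos x); first by rewrite acos_ge0// acos_lepi.
by rewrite acosK// in_itv.
Qed.

Lemma cos_itvoo (R : realType) (t : R) : 0 < t < pi -> -1 < cos t < 1.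
Proof.
move=> t0pi; have pi0 := pi_gt0 R.
by rewrite -[-1]cospi -[1 in X in _ && X]cos0 !ltr_cos_pi; lra.
Qed.

(** * Regularity of the arcsine density *)

Lemma continuous_beta_half (R : realType) (x : R) : -1 < x < 1 ->
  {for x, continuous (fun y : R => 1 / (pi * Num.sqrt (1 - y ^+ 2)))}.
Proof.
move=> x11.
have sqrt0 : Num.sqrt (1 - x ^+ 2) != 0 by rewrite sqrtr_eq0 -ltNge; nra.
apply: (@cvgM _ _ _ _ (fun=> 1) (fun y => (pi * Num.sqrt (1 - y ^+ 2))^-1)).
  exact: cvg_cst.
apply: cvgV; first by rewrite mulf_neq0// gt_eqF// pi_gt0.
apply: cvgM; first exact: cvg_cst.
apply: (@continuous_comp _ _ _ (fun y : R => 1 - y ^+ 2) (@Num.sqrt R)).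
  apply: cvgB; first exact: cvg_cst.
  exact: exprn_continuous.
exact: sqrt_continuous.
Qed.

Lemma beta_half_pdf_ge0 (R : realType) (x : R) : 0 <= beta_half_pdf x.
Proof.
rewrite /beta_half_pdf; case: ifPn => // _.
by rewrite divr_ge0// mulr_ge0 ?sqrtr_ge0// pi_ge0.
Qed.

(** On such an interval the guard [-1 < x < 1] holds, so the density agrees with a continuous
    formula. *)
Lemma measurable_beta_half_pdf (R : realType) (a b : R) :
  -1 <= a -> b <= 1 -> measurable_fun `]a, b[ (@beta_half_pdf R).
Proof.
move=> a1 b1.
apply: (@eq_measurable_fun _ _ _ _ _
  (fun y : R => 1 / (pi * Num.sqrt (1 - y ^+ 2)))).
  move=> x; rewrite inE/= in_itv/= => xab.
  by rewrite /beta_half_pdf ifT//; lra.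
apply: subspace_continuous_measurable_fun; first exact: measurable_itv.
apply: continuous_in_subspaceT.
move=> x; rewrite inE/= in_itv/= => xab.
by apply: continuous_beta_half; lra.
Qed.

(** * Arcsine law of intervals *)

Lemma beta_half_law_cc (R : realType) (a b : R) : 0 < a -> a < b -> b < pi ->
  beta_half_law `[cos b, cos a] = ((b - a) / pi)%:E.
Proof.
move=> a0 ab bpi.
have a11 : -1 < cos a < 1 by apply: cos_itvoo; lra.
have b11 : -1 < cos b < 1 by apply: cos_itvoo; lra.
have cos_ab : cos b < cos a by rewrite ltr_cos_pi; lra.
(* An antiderivative of the density. The strict bounds on [a] and [b] keep the closed interval
   inside ]-1, 1[, where [acos] is differentiable. *)
pose F (x : R) := acos x * - pi^-1.
have dF (x : R) : -1 < x < 1 ->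
    is_derive x 1 F (- (Num.sqrt (1 - x ^+ 2))^-1 * - pi^-1).
  move=> x11; have dx := is_derive1_acos x11.
  rewrite /F (_ : (fun _ => _) = (fun x => (- pi^-1) *: acos x)); last first.
    by apply/funext => y; rewrite /= mulrC.
  by rewrite mulrC; exact: is_deriveZ.
have cF (x : R) : -1 < x < 1 -> {for x, continuous F}.
  move=> /dF [dx _]; apply/differentiable_continuous.
  by rewrite -derivable1_diffP.
rewrite /beta_half_law.
transitivity (\int[lebesgue_measure]_(x in `[cos b, cos a])
    (1 / (pi * Num.sqrt (1 - x ^+ 2)))%:E)%E.
  apply: eq_integral => x; rewrite inE/= in_itv/= => xab.
  by rewrite /beta_half_pdf ifT//; lra.
rewrite (@continuous_FTC2 _ _ F)//.
- rewrite /F !cosK ?in_itv/=; [|lra|lra].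
  by rewrite -EFinB; congr (_%:E); ring.
- apply: continuous_in_subspaceT => x; rewrite inE/= in_itv/= => xab.
  by apply: continuous_beta_half; lra.
- split.
  + by move=> x; rewrite in_itv/= => xab; have [] := dF x ltac:(lra).
  + by apply: cvg_at_right_filter; exact: cF.
  + by apply: cvg_at_left_filter; exact: cF.
- move=> x; rewrite in_itv/= => xab.
  have dx := dF x ltac:(lra).
  by rewrite derive1E derive_val mulrNN mul1r invfM mulrC.
Qed.

(** Endpoints are Lebesgue-null, so all four interval types reduce to the open one, which is
    exhausted by closed intervals inside ]-1, 1[. *)
Lemma beta_half_law_itv (R : realType) (a b : R) (b0 b1 : bool) :
  0 <= a -> a <= b -> b <= pi ->
  beta_half_law [set` Interval (BSide b0 (cos b)) (BSide b1 (cos a))] =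
  ((b - a) / pi)%:E.
Proof.
move=> a0 ab bpi.
have mf : measurable_fun `]cos b, cos a[ (EFin \o @beta_half_pdf R).
  apply/measurable_EFinP; apply: measurable_beta_half_pdf.
    exact: cos_geN1.
  exact: cos_le1.
rewrite /beta_half_law integral_itv_bndoo//.
move: ab; rewrite le_eqVlt => /predU1P[<-|ab].
  by rewrite set_interval.set_itvoo0 integral_set0 subrr mul0r.
(* The density is unbounded near -1 and 1, so the bounds are approached from
   the inside. *)
pose e (n : nat) : R := (b - a) / 3 * n.+1%:R^-1.
have e_gt0 n : 0 < e n by rewrite mulr_gt0 ?invr_gt0 ?ltr0n//; lra.
(* The divisor 3 ensures [a + e n < b - e n], as [beta_half_law_cc] requires. *)
have e_le n : e n <= (b - a) / 3.
  by rewrite ler_piMr ?invf_le1 ?ltr0n ?ler1n//; lra.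
have e_ni m n : (m <= n)%N -> e n <= e m.
  move=> mn; rewrite ler_wpM2l ?lef_pV2 ?posrE ?ltr0n ?ler_nat//; lra.
have e_cvg0 : e n @[n --> \oo] --> (0 : R).
  rewrite -[X in _ --> X](mulr0 ((b - a) / 3)).
  by apply: cvgM; [exact: cvg_cst|exact: cvg_harmonic].
pose F n := `[cos (b - e n), cos (a + e n)]%classic.
have F_sub n : F n `<=` `]cos b, cos a[%classic.
  move=> x; rewrite /F /= !in_itv/= => /andP[bx xa].
  have := e_gt0 n; have := e_le n => ? ?.
  rewrite (lt_le_trans _ bx) ?ltr_cos_pi ?(le_lt_trans xa) ?ltr_cos_pi//; lra.
have F_bigcup : \bigcup_n F n = `]cos b, cos a[%classic.
  apply/seteqP; split; first by apply: bigcup_sub => n _; exact: F_sub.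
  move=> x; rewrite /= in_itv/= => /andP[bx xa].
  have [t t0pi xt] : exists2 t : R, 0 <= t <= pi & x = cos t.
    by apply: cos_acos_ex; have := cos_geN1 b; have := cos_le1 a; lra.
  move: bx xa; rewrite xt !ltr_cos_pi; [|lra..] => tb at_.
  have [n [enb ena]] : exists n, e n < b - t /\ e n < t - a.
    have /(cvgr_lt 0) nb := e_cvg0; have /(cvgr_lt 0) na := e_cvg0.
    have := nb (b - t) ltac:(lra) => {}nb.
    have := na (t - a) ltac:(lra) => {}na.
    have [N _ HN] := filterI nb na.
    by exists N; apply: HN => /=.
  exists n => //; rewrite /F /= in_itv/=; have := e_gt0 n => ?.
  by rewrite !ler_cos_pi; lra.
have F_int n : (\int[lebesgue_measure]_(x in F n) (beta_half_pdf x)%:E =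
    ((b - a - e n *+ 2) / pi)%:E)%E.
  have := e_gt0 n; have := e_le n => ? ?.
  by rewrite [LHS]beta_half_law_cc; [congr (_%:E); ring|lra..].
rewrite -F_bigcup.
have nd_F : nondecreasing_seq F.
  move=> m n mn; rewrite subsetEset => x; rewrite /F /= !in_itv/=.
  have := e_gt0 n; have := e_le m; have := e_ni _ _ mn => ? ? ?.
  move=> /andP[bx xa].
  rewrite (le_trans _ bx) ?(le_trans xa) ?ler_cos_pi//; lra.
(* Monotone convergence along the increasing [F n]; the values (b - a - 2 e n) / pi tend to (b - a)
   / pi. *)
have : (\int[lebesgue_measure]_(x in F n) (beta_half_pdf x)%:E @[n --> \oo] -->
    \int[lebesgue_measure]_(x in \bigcup_n F n) (beta_half_pdf x)%:E)%E.
  apply: ge0_nondecreasing_set_cvg_integral => //.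
  - by move=> n; exact: measurable_itv.
  - by move=> n; apply: measurable_funS mf.
  - by move=> n x _; rewrite lee_fin beta_half_pdf_ge0.
move=> /cvg_lim <-//; apply: cvg_lim => //.
under eq_fun do rewrite F_int.
apply: cvg_EFin; first exact: nearW.
rewrite -[X in _ --> X](_ : (b - a - 0 *+ 2) / pi = _); last by rewrite mul0rn subr0.
apply: cvgM; last exact: cvg_cst.
apply: cvgB; first exact: cvg_cst.
by rewrite mulr2n; under eq_fun do rewrite mulr2n; exact: cvgD.
Qed.

(** * Superlevel sets of T_k, cell by cell *)

Lemma chebyshevT_cos (R : realType) (k : nat) (t : R) : 0 <= t <= pi ->
  (chebyshevT R k).[cos t] = cos (k%:R * t).
Proof.
move=> t0pi; rewrite chebyshevTP ?cosK ?in_itv//=.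
by rewrite cos_geN1 cos_le1.
Qed.

(* With [x = cos t], [T_k x = cos (k t)] is monotone for [t] between [m pi/k]
   and [(m+1) pi/k] (decreasing in [t] iff [m] is even), hence the superlevel
   set is a single interval there. *)
Lemma chebyshevT_cell (R : realType) (k m : nat) (g : R) (h := pi / k%:R) :
  (m < k)%N -> 0 <= g -> g < h ->
  [set x | cos (m%:R * h + h) < x <= cos (m%:R * h) /\
           cos (k%:R * g) <= (chebyshevT R k).[x]] =
  if odd m then `]cos (m%:R * h + h), cos (m%:R * h + h - g)]%classic
  else `[cos (m%:R * h + g), cos (m%:R * h)]%classic.
Proof.
move=> mk g0 gh.
have k0 : 0 < k%:R :> R by rewrite ltr0n (leq_trans _ mk).
have kh : k%:R * h = pi by rewrite /h; field; rewrite gt_eqF.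
clearbody h.
have M0 : 0 <= m%:R * h by rewrite mulr_ge0//; lra.
have Mpi : m%:R * h + h <= pi.
  by rewrite -kh -[X in _ + X]mul1r -mulrDl natr1 ler_pM2r ?ler_nat//; lra.
set M := m%:R * h in M0 Mpi *.
(* Since k M = m pi, moving the origin of angles to [M] costs the sign (-1)^m. *)
have cosM (t : R) : cos (k%:R * t) = (-1) ^+ m * cos (k%:R * (t - M)).
  have -> : k%:R * t = k%:R * (t - M) + pi *+ m.
    by rewrite -mulr_natl /M -kh; ring.
  by rewrite (alternatingn (@cosDpi R)).
have k_pi (t : R) : 0 <= t <= h -> 0 <= k%:R * t <= pi.
  by move=> /andP[t0 th]; rewrite -kh mulr_ge0 ?ler_pM2l//; lra.
have cosM_ge (t : R) : M <= t <= M + h ->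
    (cos (k%:R * g) <= cos (k%:R * t)) =
    if odd m then M + h - g <= t else t <= M + g.
  move=> tM; rewrite [cos (_ * t)]cosM -signr_odd; case: odd.
    rewrite expr1 mulN1r.
    (* For odd [m] the sign is absorbed by - cos u = cos (pi - u), which reverses the cell: the arc
       sits at its far end. *)
    have -> : - cos (k%:R * (t - M)) = cos (k%:R * (h - (t - M))).
      by rewrite -(cosN (_ * _)) -cosDpi -kh; congr cos; ring.
    by rewrite ler_cos_pi ?k_pi ?ler_pM2l//; lra.
  rewrite expr0 mul1r.
  by rewrite ler_cos_pi ?k_pi ?ler_pM2l//; lra.
apply/seteqP; split => [x [/andP[Mhx xM]]|x].
  have [t t0pi xt] : exists2 t : R, 0 <= t <= pi & x = cos t.
    apply: cos_acos_ex; have := cos_geN1 (M + h); have := cos_le1 M; lra.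
  move: Mhx xM; rewrite xt ltr_cos_pi ?ler_cos_pi; [|lra..] => tM Mt.
  rewrite chebyshevT_cos// cosM_ge; last lra.
  by case: odd; rewrite /= in_itv/= => ?; rewrite ?ltr_cos_pi ?ler_cos_pi; lra.
(* The target intervals are bounded by cosines, which excludes points outside [-1, 1] before passing
   to the angle. *)
have [x11|x11] := boolP (-1 <= x <= 1); last first.
  case: odd; rewrite /= in_itv/= => ?; exfalso; move/negP: x11; apply.
    have := cos_geN1 (M + h); have := cos_le1 (M + h - g); lra.
  have := cos_geN1 (M + g); have := cos_le1 M; lra.
have [t t0pi ->] := cos_acos_ex x11 => tI.
have tM : M <= t <= M + h.
  by move: tI; case: odd;
    rewrite /= in_itv/= ?ltr_cos_pi ?ler_cos_pi ?ler_cos_pi; lra.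
rewrite /= ltr_cos_pi ?ler_cos_pi ?chebyshevT_cos ?cosM_ge//; [|lra..].
by move: tI; case: odd;
  rewrite /= in_itv/= ?ltr_cos_pi ?ler_cos_pi ?ler_cos_pi; lra.
Qed.

Lemma measurable_chebyshevT_superlevel (R : realType) (k : nat) (c : R)
    (I : interval R) :
  measurable [set x | x \in I /\ c <= (chebyshevT R k).[x]].
Proof.
have -> : [set x | x \in I /\ c <= (chebyshevT R k).[x]] =
    [set` I] `&` horner (chebyshevT R k) @^-1` `[c, +oo[%classic.
  by apply/seteqP; split => x [xI Tx]; split=> //; move: Tx;
    rewrite /= in_itv/= andbT.
apply: measurableI; first exact: measurable_itv.
rewrite -[X in measurable X]setTI.
by apply: measurable_poly => //; exact: measurable_itv.
Qed.

(** Induction on [m]: each new cell meets the superlevel set in an arc of length [g], of law g / pi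
    for either parity. Additivity comes from the measure [mu], [beta_half_law] being given only as a
    set function. *)
Lemma chebyshevT_superlevel_law (R : realType)
    (mu : {measure set R -> \bar R}) (k m : nat) (g : R) (h := pi / k%:R) :
  (forall A : set R, measurable A -> mu A = beta_half_law A) ->
  (m <= k)%N -> 0 <= g -> g < h ->
  mu [set x | x \in `]cos (m%:R * h), 1] /\
              cos (k%:R * g) <= (chebyshevT R k).[x]] =
  (m%:R * g / pi)%:E.
Proof.
move=> muE mk g0 gh; elim: m mk => [_|m IH mk].
  rewrite (_ : [set x | _] = set0) ?measure0 ?mul0r//.
  apply/seteqP; split => // x [+ _].
  by rewrite cos0 in_itv/=; lra.
have k0 : 0 < k%:R :> R by rewrite ltr0n (leq_trans _ mk).
have kh : k%:R * h = pi by rewrite /h; field; rewrite gt_eqF.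
have M0 : 0 <= m%:R * h by rewrite mulr_ge0//; lra.
have Mpi : m%:R * h + h <= pi.
  by rewrite -kh -[X in _ + X]mul1r -mulrDl natr1 ler_pM2r ?ler_nat//; lra.
have := chebyshevT_cell mk g0 gh; rewrite -/h => cell.
have mcell : measurable [set x | cos (m%:R * h + h) < x <= cos (m%:R * h) /\
           cos (k%:R * g) <= (chebyshevT R k).[x]].
  by rewrite cell; case: ifP => _; exact: measurable_itv.
have cos_le : cos (m%:R * h + h) <= cos (m%:R * h) by rewrite ler_cos_pi; lra.
have cos_le1M := cos_le1 (m%:R * h).
(* Cut at cos (m h): the points strictly above form the set of the induction hypothesis, the others
   form cell [m]. *)
rewrite (_ : [set x | _] =
    [set x | x \in `]cos (m%:R * h), 1] /\
             cos (k%:R * g) <= (chebyshevT R k).[x]] `|`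
    [set x | cos (m%:R * h + h) < x <= cos (m%:R * h) /\
             cos (k%:R * g) <= (chebyshevT R k).[x]]); last first.
  rewrite -natr1 mulrDl mul1r.
  apply/seteqP; split => x /=; rewrite !in_itv/=.
    move=> [xI Tx]; have [?|?] := leP x (cos (m%:R * h)); [right|left];
      split => //; lra.
  by move=> [|] [xI Tx]; split => //; lra.
rewrite measureU//; last 2 first.
- exact: measurable_chebyshevT_superlevel.
- by apply/seteqP; split => // x [] /= [] + _ [] + _; rewrite in_itv/=; lra.
have -> : (m.+1%:R * g / pi)%:E = ((m%:R * g / pi)%:E + (g / pi)%:E)%E.
  by rewrite -EFinD -natr1; congr (_%:E); ring.
congr (_ + _)%E; first exact/IH/ltnW.
apply: (etrans (muE _ mcell)); rewrite cell.
by case: ifP => _; (rewrite beta_half_law_itv; [congr (_%:E); ring|lra..]).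
Qed.

(** * Invariance, from half-lines to all Borel sets *)

Theorem theorem5p1 (R : realType) (k : nat) (hk : (1 <= k)%N)
    (d : measure_display) (T : measurableType d) (P : probability T R)
    (X : {RV P >-> R})
    (X_itv : forall t : T, X t \in `[-1, 1])
    (X_law : forall A : set R, measurable A ->
       distribution P X A = beta_half_law A) :
  (forall A : set R, measurable A ->
     distribution P (horner (chebyshevT R k) \o X) A = distribution P X A) /\
  (forall A : set R, measurable A ->
     pushforward (@beta_half_law R) (horner (chebyshevT R k)) A =
     beta_half_law A).
Proof.
(* The second claim is the first read through [X_law], applied to [A] and to its preimage under
   T_k. *)
suff TX : forall A : set R, measurable A ->
    distribution P (horner (chebyshevT R k) \o X) A = distribution P X A.
  split=> // A mA; rewrite -X_law// -TX// /pushforward -X_law//.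
  by rewrite -[X in measurable X]setTI; exact: measurable_poly.
(* The half-lines [- n, +oo[ cover the line with finite measure, as uniqueness of measures needs. *)
apply: (measure_unique (@RGenCInfty.G R) (fun n => `[- n%:R, +oo[%classic)).
- exact: RGenCInfty.measurableE.
- move=> _ _ [x ->] [y ->]; exists (Num.max x y).
  by apply/seteqP; split => z /=; rewrite !in_itv/= !andbT ge_max => /andP.
- by move=> n; exists (- n%:R).
- apply/seteqP; split => // x _; exists (Num.truncn (- x)).+1 => //=.
  by rewrite in_itv/= andbT lerNl ltW// truncnS_gt.
- move=> _ [c ->].
  (* [X] and T_k(X) take values in [-1, 1]: for c <= -1 both events are certain, for c > 1 both are
     impossible. *)
  have [c11|c11] := boolP (-1 < c <= 1); last first.
    congr (P _); apply/seteqP; split => t /=; rewrite !in_itv/= !andbT;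
      have := X_itv t; have := chebyshevT_itv k (X_itv t);
      move: c11; rewrite negb_and -leNgt -ltNge !in_itv/= => /orP[]; lra.
  have [g g0pi cg] : exists2 g : R, 0 <= g <= pi & c = cos g.
    by apply: cos_acos_ex; lra.
  have gpi : g < pi by rewrite -ltr_cos_pi ?cospi//; have := pi_ge0 R; lra.
  have k0 : 0 < k%:R :> R by rewrite ltr0n.
  (* The singleton is the degenerate interval with both angles equal to pi. *)
  have mu1 : distribution P X [set -1] = 0%E.
    rewrite X_law// -set_itv1 -cospi beta_half_law_itv//; last exact: pi_ge0.
    by rewrite subrr mul0r.
  have kk : k%:R * (pi / k%:R) = pi :> R by field; rewrite gt_eqF.
  have kg : k%:R * (g / k%:R) = g :> R by field; rewrite gt_eqF.
  (* All [k] cells, with angle g / k: together they fill ]-1, 1], and the total law is k (g / k) /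
     pi = g / pi. *)
  have := @chebyshevT_superlevel_law R (distribution P X) k k (g / k%:R) X_law.
  rewrite kk kg cospi -cg => /(_ (leqnn k)) SE.
  have lawI : distribution P X `[c, +oo[ = (g / pi)%:E.
    transitivity (distribution P X `[c, 1]).
      congr (P _); apply/seteqP; split => t /=; rewrite !in_itv/=;
        have := X_itv t; rewrite in_itv/=; lra.
    rewrite X_law; last exact: measurable_itv.
    by rewrite cg -{1}cos0 beta_half_law_itv ?subr0//; lra.
  pose TI := horner (chebyshevT R k) @^-1` `[c, +oo[%classic.
  suff lawTI : distribution P X TI = (g / pi)%:E.
    exact: etrans lawTI (esym lawI).
  rewrite -SE ?divr_ge0 ?ltr_pM2r ?invr_gt0//; [|lra..].
  set S := [set x | _].
  have mS : measurable S by exact: measurable_chebyshevT_superlevel.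
  have mTI : measurable TI.
    rewrite -[X in measurable X]setTI.
    by apply: measurable_poly => //; exact: measurable_itv.
  (* [acos x < pi] throughout [S], so [S] may miss the point -1. *)
  rewrite -(measureU0 mTI (measurable_set1 (-1)) mu1).
  rewrite -(measureU0 mS (measurable_set1 (-1)) mu1).
  (* The sets are compared as events of the sample space: [X_itv] rules out the points of [TI]
     outside [-1, 1]. *)
  congr (P _); apply/seteqP; split => t /= [Tt|->]; try by right.
    have [->|Xt] := eqVneq (X t) (-1); [by right|left].
    move: Tt; rewrite /TI /= in_itv/= andbT => Tt; split=> //; rewrite in_itv/=.
    by rewrite lt_neqAle eq_sym Xt; have := X_itv t; rewrite in_itv.
  by left; move: Tt; rewrite /S /TI /= !in_itv/= andbT => -[].
- move=> n; rewrite ltey_eq fin_num_measure//; exact: measurable_itv.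
Qed.
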